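(* Let $\overline{A_1A_2A_3}$ be a triangle in the plane over a field of characteristic not two. For each colour (blue, red or green), the nine-point circle of that colour of $\overline{A_1A_2A_3}$ passes through the feet of the altitudes of that colour (from each point of the triangle to the opposite line, whenever that line is non-null in that colour so that the foot is defined), as well as through the midpoints of the segments from the orthocenter of the same colour to the points $A_1,A_2$ and $A_3$. In addition it passes through the circumcenters of $\overline{A_1A_2A_3}$ of the other two colours.
   Context: Work over a fixed field not of characteristic two. A point is an ordered pair $[x,y]$ of field elements. A line is a proportion $\langle a:b:c\rangle$ with $a,b$ not both zero; the point $[x,y]$ lies on it precisely when $ax+by+c=0$. Lines $\langle a_1:b_1:c_1\rangle$ and $\langle a_2:b_2:c_2\rangle$ are blue perpendicular when $a_1a_2+b_1b_2=0$, red perpendicular when $a_1a_2-b_1b_2=0$, and green perpendicular when $a_1b_2+b_1a_2=0$. A line is null in a given colour precisely when it is perpendicular to itself in that colour, i.e. $\langle a:b:c\rangle$ is blue null when $a^2+b^2=0$, red null when $a^2-b^2=0$, green null when $2ab=0$; otherwise it is non-null in that colour. A triangle $\overline{A_1A_2A_3}$ is a set of three distinct non-collinear points. For each colour, the altitude of that colour from a point $A$ to a line $l$ is the unique line through $A$ perpendicular to $l$ in that colour; if $l$ is non-null in that colour, the altitude meets $l$ in a unique point called the foot. The orthocenter of a given colour of a triangle is the common point of the three altitudes of that colour from its points to the opposite lines. The perpendicular bisector of a given colour of a side $\overline{A_iA_j}$ is the altitude of that colour from the midpoint of $A_i$ and $A_j$ to the line $A_iA_j$; the circumcenter of a given colour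 is the common point of the three perpendicular bisectors of that colour. (These common points always exist and are unique.) A blue, red or green circle is an equation in $x,y$ of the form $(x-x_0)^2+(y-y_0)^2=K$, $(x-x_0)^2-(y-y_0)^2=K$, or $2(x-x_0)(y-y_0)=K$ respectively; it passes through a point when the coordinates of the point satisfy the equation. The nine-point circle of a given colour of $\overline{A_1A_2A_3}$ is the unique circle of that colour passing through the three midpoints of the sides of $\overline{A_1A_2A_3}$. *)

(* Defs.v *)
From mathcomp Require Import all_boot all_order all_algebra.
From mathcomp Require Import generic_quotient.
From mathcomp Require Import ring.

Set Implicit Arguments.
Unset Strict Implicit.
Unset Printing Implicit Defensive.

Import GRing.Theory.
Local Open Scope ring_scope.
Local Open Scope quotient_scope.

(* Every definite description of the theory (the line through two points, the
   altitude, the foot, the orthocenter, the circumcenter, the nine-point circle)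
   is obtained by [xchoose] from its defining property; for each such [d], the
   lemmas [dP] and [d_unique] state this property and uniqueness. *)

Inductive colour := Blue | Red | Green.

Definition point (F : fieldType) : Type := (F * F)%type.

Definition coefs (F : fieldType) : Type :=
  {t : F * F * F | (t.1.1 != 0) || (t.1.2 != 0)}.

Definition proportional (F : fieldType) (s t : coefs F) : bool :=
  let: (a1, b1, c1) := val s in
  let: (a2, b2, c2) := val t in
  [&& a1 * b2 == a2 * b1, a1 * c2 == a2 * c1 & b1 * c2 == b2 * c1].

Lemma proportional_refl (F : fieldType) : reflexive (@proportional F).
Proof. by case=> [[[a b] c] h]; rewrite /proportional /= !eqxx. Qed.

Lemma proportional_sym (F : fieldType) : symmetric (@proportional F).
Proof.
case=> [[[a b] c] h] [[[a' b'] c'] h']; rewrite /proportional /=.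
by congr [&& _, _ & _]; rewrite eq_sym.
Qed.

Lemma proportionalP (F : fieldType) (s t : coefs F) :
  reflect (exists2 k, k != 0 &
             val t = (k * (val s).1.1, k * (val s).1.2, k * (val s).2))
          (proportional s t).
Proof.
case: s t => [[[a b] c] /= h] [[[a' b'] c'] /= h']; rewrite /proportional /=.
apply: (iffP and3P) => [[/eqP e1 /eqP e2 /eqP e3] | [k _ [-> -> ->]]]; last first.
  by split; apply/eqP; ring.
have [a0|a0] := eqVneq a 0.
  have b0 : b != 0 by move: h; rewrite a0 eqxx.
  have a'0 : a' = 0.
    by move: e1; rewrite a0 mul0r => /esym/eqP; rewrite mulf_eq0 (negPf b0) orbF => /eqP.
  move: h'; rewrite a'0 eqxx /= => b'0.
  exists (b' / b); first by rewrite mulf_neq0 ?invr_eq0.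
  congr (_, _, _); first by rewrite a0 mulr0.
    by rewrite mulfVK.
  by rewrite mulrAC -e3 mulrAC divff // mul1r.
have a'0 : a' != 0.
  apply/negP => /eqP a'0; move: e1 h'; rewrite a'0 eqxx mul0r /= => /eqP.
  by rewrite mulf_eq0 (negPf a0) /= => ->.
exists (a' / a); first by rewrite mulf_neq0 ?invr_eq0.
congr (_, _, _); first by rewrite mulfVK.
  by rewrite mulrAC -e1 mulrAC divff // mul1r.
by rewrite mulrAC -e2 mulrAC divff // mul1r.
Qed.

Lemma proportional_trans (F : fieldType) : transitive (@proportional F).
Proof.
move=> t s u /proportionalP[k k0 e] /proportionalP[l l0 f].
apply/proportionalP; exists (l * k); first exact: mulf_neq0.
by rewrite f e /= !mulrA.
Qed.

Canonical proportional_equiv (F : fieldType) :=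
  EquivRel (@proportional F) (@proportional_refl F) (@proportional_sym F)
    (@proportional_trans F).

Definition line (F : fieldType) : Type :=
  {eq_quot (proportional_equiv F)}.

Definition mk_line (F : fieldType) (a b c : F) (h : (a != 0) || (b != 0)) :
  line F := \pi_(line F) (Sub (a, b, c) h : coefs F).

Lemma lineP (F : fieldType) (l : line F) :
  exists a b c, exists h : (a != 0) || (b != 0), l = mk_line c h.
Proof.
rewrite -[l]reprK; case: (repr l) => [[[a b] c] h].
by exists a, b, c, h.
Qed.

Definition on (F : fieldType) (P : point F) (l : line F) : bool :=
  let: (a, b, c) := val (repr l) in a * P.1 + b * P.2 + c == 0.

Definition perp (F : fieldType) (col : colour) (l m : line F) : bool :=
  let: (a1, b1, _) := val (repr l) in
  let: (a2, b2, _) := val (repr m) in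
  match col with
  | Blue => a1 * a2 + b1 * b2 == 0
  | Red => a1 * a2 - b1 * b2 == 0
  | Green => a1 * b2 + b1 * a2 == 0
  end.

Definition null (F : fieldType) (col : colour) (l : line F) : bool :=
  perp col l l.

Lemma repr_mk_line (F : fieldType) (a b c : F) (h : (a != 0) || (b != 0)) :
  exists2 k, k != 0 & val (repr (mk_line c h)) = (k * a, k * b, k * c).
Proof.
have: proportional (Sub (a, b, c) h) (repr (mk_line c h)).
  by rewrite -[proportional _ _]/(proportional_equiv F _ _); apply/eqmodP; rewrite reprK.
by case/proportionalP => k k0 e; exists k.
Qed.

Lemma on_mk_line (F : fieldType) (P : point F) (a b c : F)
    (h : (a != 0) || (b != 0)) :
  on P (mk_line c h) = (a * P.1 + b * P.2 + c == 0).
Proof.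
rewrite /on; have [k k0 ->] := repr_mk_line c h.
rewrite -[RHS](mulrI_eq0 _ (mulfI k0)); congr (_ == 0); ring.
Qed.

Lemma perp_mk_line (F : fieldType) (col : colour) (a1 b1 c1 a2 b2 c2 : F)
    (h1 : (a1 != 0) || (b1 != 0)) (h2 : (a2 != 0) || (b2 != 0)) :
  perp col (mk_line c1 h1) (mk_line c2 h2) =
  match col with
  | Blue => a1 * a2 + b1 * b2 == 0
  | Red => a1 * a2 - b1 * b2 == 0
  | Green => a1 * b2 + b1 * a2 == 0
  end.
Proof.
rewrite /perp; have [k k0 ->] := repr_mk_line c1 h1.
have [l l0 ->] := repr_mk_line c2 h2.
have kl0 := mulf_neq0 k0 l0.
by case: col; rewrite -[RHS](mulrI_eq0 _ (mulfI kl0)); congr (_ == 0); ring.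
Qed.

Lemma eq_mk_line (F : fieldType) (a1 b1 c1 a2 b2 c2 : F)
    (h1 : (a1 != 0) || (b1 != 0)) (h2 : (a2 != 0) || (b2 != 0)) :
  [/\ a1 * b2 = a2 * b1, a1 * c2 = a2 * c1 & b1 * c2 = b2 * c1] ->
  mk_line c1 h1 = mk_line c2 h2.
Proof.
case=> e1 e2 e3; apply/eqmodP => /=.
by rewrite /proportional /= e1 e2 e3 !eqxx.
Qed.

Lemma join_coefs (F : fieldType) (P Q : point F) :
  P != Q -> (P.2 - Q.2 != 0) || (Q.1 - P.1 != 0).
Proof.
apply: contraNT; rewrite negb_or !negbK !subr_eq0 => /andP[/eqP e2 /eqP e1].
by apply/eqP; move: P Q e1 e2 => [x y] [x' y'] /= -> ->.
Qed.

Definition join_line (F : fieldType) (P Q : point F) (PQ : P != Q) : line F :=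
  mk_line (P.1 * Q.2 - Q.1 * P.2) (join_coefs PQ).

Lemma join_exists (F : fieldType) (P Q : point F) :
  P != Q -> exists l : line F, on P l && on Q l.
Proof.
move=> PQ; exists (join_line PQ); rewrite !on_mk_line.
by apply/andP; split; apply/eqP; ring.
Qed.

Definition join (F : fieldType) (P Q : point F) (PQ : P != Q) : line F :=
  xchoose (join_exists PQ).

Lemma joinP (F : fieldType) (P Q : point F) (PQ : P != Q) :
  on P (join PQ) && on Q (join PQ).
Proof. exact: (xchooseP (join_exists PQ)). Qed.

Lemma joinE (F : fieldType) (P Q : point F) (PQ : P != Q) (l : line F) :
  on P l -> on Q l -> l = join_line PQ.
Proof.
have [a [b [c [h ->]]]] := lineP l; rewrite !on_mk_line => /eqP p /eqP q.
have c1 : c = - (a * P.1 + b * P.2) by rewrite -[LHS]subr0 -p; ring.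
have c2 : a * (Q.1 - P.1) = b * (P.2 - Q.2).
  by apply/eqP; rewrite -subr_eq0 -[X in _ == X](subrr 0) -{1}q -p; apply/eqP; ring.
apply: eq_mk_line; split; first by rewrite c2; ring.
- rewrite c1; transitivity (a * (P.1 * (Q.2 - P.2)) - (a * (Q.1 - P.1)) * P.2).
    by ring.
  by rewrite c2; ring.
- rewrite c1; transitivity ((b * (P.2 - Q.2)) * (- P.1) - b * (Q.1 - P.1) * P.2).
    by ring.
  by rewrite -c2; ring.
Qed.

Lemma join_unique (F : fieldType) (P Q : point F) (PQ : P != Q) (l : line F) :
  on P l -> on Q l -> l = join PQ.
Proof.
move=> p q; have /andP[p' q'] := joinP PQ.
by rewrite (joinE PQ p q) (joinE PQ p' q').
Qed.

Lemma altitude_exists (F : fieldType) (col : colour) (P : point F) (l : line F) :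
  exists m : line F, on P m && perp col m l.
Proof.
have [a [b [c [h ->]]]] := lineP l.
case: col.
- have h' : (- b != 0) || (a != 0) by rewrite oppr_eq0 orbC.
  exists (mk_line (b * P.1 - a * P.2) h'); rewrite on_mk_line perp_mk_line.
  by apply/andP; split; apply/eqP; ring.
- have h' : (b != 0) || (a != 0) by rewrite orbC.
  exists (mk_line (- b * P.1 - a * P.2) h'); rewrite on_mk_line perp_mk_line.
  by apply/andP; split; apply/eqP; ring.
- have h' : (a != 0) || (- b != 0) by rewrite oppr_eq0.
  exists (mk_line (b * P.2 - a * P.1) h'); rewrite on_mk_line perp_mk_line.
  by apply/andP; split; apply/eqP; ring.
Qed.

Definition altitude (F : fieldType) (col : colour) (P : point F) (l : line F) :
  line F := xchoose (altitude_exists col P l).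

Lemma altitudeP (F : fieldType) (col : colour) (P : point F) (l : line F) :
  on P (altitude col P l) && perp col (altitude col P l) l.
Proof. exact: (xchooseP (altitude_exists col P l)). Qed.

Lemma parallel_of_orth (F : fieldType) (a b a1 b1 a2 b2 : F) :
  (a != 0) || (b != 0) ->
  a1 * a + b1 * b = 0 -> a2 * a + b2 * b = 0 -> a1 * b2 = a2 * b1.
Proof.
move=> h e1 e2; apply/eqP; rewrite -subr_eq0; case/orP: h => h.
- rewrite -(mulrI_eq0 _ (mulfI h)).
  have ->: a * (a1 * b2 - a2 * b1) =
           b2 * (a1 * a + b1 * b) - b1 * (a2 * a + b2 * b) by ring.
  by rewrite e1 e2 !mulr0 subr0.
- rewrite -(mulrI_eq0 _ (mulfI h)).
  have ->: b * (a1 * b2 - a2 * b1) =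
           a1 * (a2 * a + b2 * b) - a2 * (a1 * a + b1 * b) by ring.
  by rewrite e1 e2 !mulr0 subr0.
Qed.

Lemma parallel_eq (F : fieldType) (P : point F) (a1 b1 c1 a2 b2 c2 : F)
    (h1 : (a1 != 0) || (b1 != 0)) (h2 : (a2 != 0) || (b2 != 0)) :
  a1 * b2 = a2 * b1 -> on P (mk_line c1 h1) -> on P (mk_line c2 h2) ->
  mk_line c1 h1 = mk_line c2 h2.
Proof.
rewrite !on_mk_line => e /eqP p1 /eqP p2; apply: eq_mk_line.
have -> : c1 = - (a1 * P.1 + b1 * P.2) by rewrite -[LHS]subr0 -p1; ring.
have -> : c2 = - (a2 * P.1 + b2 * P.2) by rewrite -[LHS]subr0 -p2; ring.
split=> //.
  transitivity (- (a1 * a2 * P.1) - (a1 * b2) * P.2); first by ring.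
  by rewrite e; ring.
transitivity (- (a2 * b1) * P.1 - b1 * b2 * P.2); first by ring.
by rewrite -e; ring.
Qed.

Lemma altitude_unique (F : fieldType) (col : colour) (P : point F)
    (l m : line F) :
  on P m -> perp col m l -> m = altitude col P l.
Proof.
have /andP[] := altitudeP col P l; move: (altitude col P l) => n.
have [a [b [c [h ->]]]] := lineP l.
have [a1 [b1 [c1 [h1 ->]]]] := lineP m.
have [a2 [b2 [c2 [h2 ->]]]] := lineP n.
rewrite !perp_mk_line => p2 e2 p1 e1; apply: parallel_eq p1 p2.
case: col e1 e2 => /eqP e1 /eqP e2.
- exact: parallel_of_orth h e1 e2.
- apply: (@parallel_of_orth _ a (- b)); first by rewrite oppr_eq0.
    by rewrite mulrN.
  by rewrite mulrN.
- by apply: (@parallel_of_orth _ b a); rewrite 1?orbC.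
Qed.

Lemma cramer2 (F : fieldType) (a1 b1 c1 a2 b2 c2 : F) :
  a1 * b2 - a2 * b1 != 0 ->
  exists P : point F,
    (a1 * P.1 + b1 * P.2 + c1 == 0) && (a2 * P.1 + b2 * P.2 + c2 == 0).
Proof.
move=> d; exists ((b1 * c2 - b2 * c1) / (a1 * b2 - a2 * b1),
                 (a2 * c1 - a1 * c2) / (a1 * b2 - a2 * b1)) => /=.
by apply/andP; split; apply/eqP; field.
Qed.

Lemma cramer2_unique (F : fieldType) (a1 b1 c1 a2 b2 c2 : F) (P Q : point F) :
  a1 * b2 - a2 * b1 != 0 ->
  a1 * P.1 + b1 * P.2 + c1 = 0 -> a2 * P.1 + b2 * P.2 + c2 = 0 ->
  a1 * Q.1 + b1 * Q.2 + c1 = 0 -> a2 * Q.1 + b2 * Q.2 + c2 = 0 -> P = Q.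
Proof.
move: P Q => [x y] [x' y'] /= d p1 p2 q1 q2.
congr (_, _); apply/eqP; rewrite -subr_eq0 -(mulrI_eq0 _ (mulfI d)).
- rewrite [X in X == _](_ : _ =
    b2 * ((a1 * x + b1 * y + c1) - (a1 * x' + b1 * y' + c1))
    - b1 * ((a2 * x + b2 * y + c2) - (a2 * x' + b2 * y' + c2))); last by ring.
  by rewrite p1 p2 q1 q2 !subrr !mulr0 subrr.
- rewrite [X in X == _](_ : _ =
    a1 * ((a2 * x + b2 * y + c2) - (a2 * x' + b2 * y' + c2))
    - a2 * ((a1 * x + b1 * y + c1) - (a1 * x' + b1 * y' + c1))); last by ring.
  by rewrite p1 p2 q1 q2 !subrr !mulr0 subrr.
Qed.

Lemma perp_cross (F : fieldType) (col : colour) (a b c a1 b1 c1 : F)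
    (h : (a != 0) || (b != 0)) (h1 : (a1 != 0) || (b1 != 0)) :
  perp col (mk_line c1 h1) (mk_line c h) -> ~~ null col (mk_line c h) ->
  a1 * b - a * b1 != 0.
Proof.
rewrite /null !perp_mk_line => e; apply: contra; rewrite subr_eq0 => /eqP x.
case: col e => /eqP e; case/orP: h1 => h1; rewrite -(mulrI_eq0 _ (mulfI h1)).
- rewrite [X in X == _](_ : _ = a * (a1 * a + b1 * b) + b * (a1 * b - a * b1)); last by ring.
  by rewrite e x subrr !mulr0 addr0.
- rewrite [X in X == _](_ : _ = b * (a1 * a + b1 * b) - a * (a1 * b - a * b1)); last by ring.
  by rewrite e x subrr !mulr0 subr0.
- rewrite [X in X == _](_ : _ = a * (a1 * a - b1 * b) - b * (a1 * b - a * b1)); last by ring.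
  by rewrite e x subrr !mulr0 subr0.
- rewrite [X in X == _](_ : _ = b * (a1 * a - b1 * b) - a * (a1 * b - a * b1)); last by ring.
  by rewrite e x subrr !mulr0 subr0.
- rewrite [X in X == _](_ : _ = a * (a1 * b + b1 * a) + a * (a1 * b - a * b1)); last by ring.
  by rewrite e x subrr !mulr0 addr0.
- rewrite [X in X == _](_ : _ = b * (a1 * b + b1 * a) - b * (a1 * b - a * b1)); last by ring.
  by rewrite e x subrr !mulr0 subr0.
Qed.

Lemma foot_exists (F : fieldType) (col : colour) (P : point F) (l : line F) :
  ~~ null col l -> exists Q : point F, on Q (altitude col P l) && on Q l.
Proof.
have /andP[_] := altitudeP col P l; move: (altitude col P l) => m.
have [a [b [c [h ->]]]] := lineP l; have [a1 [b1 [c1 [h1 ->]]]] := lineP m.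
move=> e n; have [Q] := cramer2 c1 c (perp_cross e n).
by exists Q; rewrite !on_mk_line.
Qed.

Definition foot (F : fieldType) (col : colour) (P : point F) (l : line F)
    (nn : ~~ null col l) : point F := xchoose (foot_exists P nn).

Lemma footP (F : fieldType) (col : colour) (P : point F) (l : line F)
    (nn : ~~ null col l) :
  on (foot P nn) (altitude col P l) && on (foot P nn) l.
Proof. exact: (xchooseP (foot_exists P nn)). Qed.

Lemma foot_unique (F : fieldType) (col : colour) (P : point F) (l : line F)
    (nn : ~~ null col l) (Q : point F) :
  on Q (altitude col P l) -> on Q l -> Q = foot P nn.
Proof.
have /andP[] := footP P nn; move: (foot P nn) => R.
have /andP[_] := altitudeP col P l; move: (altitude col P l) => m.
move: nn; have [a [b [c [h ->]]]] := lineP l.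
have [a1 [b1 [c1 [h1 ->]]]] := lineP m.
rewrite !on_mk_line => n e /eqP r1 /eqP r2 /eqP q1 /eqP q2.
exact: cramer2_unique (perp_cross e n) q1 q2 r1 r2.
Qed.

Definition collinear (F : fieldType) (A : 'I_3 -> point F) : Prop :=
  exists l : line F, forall i, on (A i) l.

Record triangle (F : fieldType) := Triangle {
  vertex :> 'I_3 -> point F;
  vertex_inj : injective vertex;
  vertex_noncollinear : ~ collinear vertex
}.

Lemma vertex_neq (F : fieldType) (T : triangle F) (i : 'I_3) :
  T (ordS i) != T (ord_pred i).
Proof. by rewrite (inj_eq (@vertex_inj _ T)); case: i => [[|[|[|]]]]. Qed.

(* Sides are indexed by the opposite vertex: the vertices other than [i] are
   [ordS i] and [ord_pred i], the indices being taken modulo 3. *)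
Definition side (F : fieldType) (T : triangle F) (i : 'I_3) : line F :=
  join (vertex_neq T i).

Definition midpoint (F : fieldType) (P Q : point F) : point F :=
  ((P.1 + Q.1) / 2, (P.2 + Q.2) / 2).

Definition side_midpoint (F : fieldType) (T : triangle F) (i : 'I_3) : point F :=
  midpoint (T (ordS i)) (T (ord_pred i)).

Definition perp_bisector (F : fieldType) (col : colour) (T : triangle F)
    (i : 'I_3) : line F := altitude col (side_midpoint T i) (side T i).

(* On direction vectors (-b, a) the perpendicularity of the lines <a : b : c> is
   orthogonality for this symmetric bilinear form. *)
Definition form (F : fieldType) (col : colour) (u v : point F) : F :=
  match col with
  | Blue => u.1 * v.1 + u.2 * v.2
  | Red => u.1 * v.1 - u.2 * v.2
  | Green => u.1 * v.2 + u.2 * v.1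
  end.

Definition vec (F : fieldType) (P Q : point F) : point F :=
  (Q.1 - P.1, Q.2 - P.2).

Lemma on_altitude_join (F : fieldType) (col : colour) (P A B C : point F)
    (BC : B != C) :
  on P (altitude col A (join BC)) = (form col (vec A P) (vec B C) == 0).
Proof.
have /andP[jB jC] := joinP BC; rewrite (joinE BC jB jC).
have e (m : line F) : on A m -> perp col m (join_line BC) ->
    on P m = (form col (vec A P) (vec B C) == 0).
  move=> am pm; rewrite (altitude_unique am pm) => {m am pm}.
  case: col.
  - have h : (C.1 - B.1 != 0) || (C.2 - B.2 != 0).
      by rewrite -[C.2 - _]opprB oppr_eq0 orbC join_coefs.
    rewrite -(@altitude_unique _ Blue A _
      (mk_line (- (C.1 - B.1) * A.1 - (C.2 - B.2) * A.2) h)) ?on_mk_line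
      ?perp_mk_line /=; [congr (_ == 0); ring|apply/eqP; ring|apply/eqP; ring].
  - have h : (C.1 - B.1 != 0) || (B.2 - C.2 != 0) by rewrite orbC join_coefs.
    rewrite -(@altitude_unique _ Red A _
      (mk_line (- (C.1 - B.1) * A.1 - (B.2 - C.2) * A.2) h)) ?on_mk_line
      ?perp_mk_line /=; [congr (_ == 0); ring|apply/eqP; ring|apply/eqP; ring].
  - have h : (C.2 - B.2 != 0) || (C.1 - B.1 != 0).
      by rewrite -[C.2 - _]opprB oppr_eq0 join_coefs.
    rewrite -(@altitude_unique _ Green A _
      (mk_line (- (C.2 - B.2) * A.1 - (C.1 - B.1) * A.2) h)) ?on_mk_line
      ?perp_mk_line /=; [congr (_ == 0); ring|apply/eqP; ring|apply/eqP; ring].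
by have /andP[am pm] := altitudeP col A (join_line BC); apply: e.
Qed.

Lemma form_solve (F : fieldType) (col : colour) (u v : point F) (k l : F) :
  u.1 * v.2 - u.2 * v.1 != 0 ->
  exists P : point F, form col P u = k /\ form col P v = l.
Proof.
case: u v => [u1 u2] [v1 v2] /= d; case: col.
- by exists ((k * v2 - l * u2) / (u1 * v2 - u2 * v1),
          (l * u1 - k * v1) / (u1 * v2 - u2 * v1)); split => /=; field.
- by exists ((k * v2 - l * u2) / (u1 * v2 - u2 * v1),
          - (l * u1 - k * v1) / (u1 * v2 - u2 * v1)); split => /=; field.
- by exists ((l * u1 - k * v1) / (u1 * v2 - u2 * v1),
          (k * v2 - l * u2) / (u1 * v2 - u2 * v1)); split => /=; field.
Qed.

Lemma form_inj (F : fieldType) (col : colour) (u v P Q : point F) :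
  u.1 * v.2 - u.2 * v.1 != 0 ->
  form col P u = form col Q u -> form col P v = form col Q v -> P = Q.
Proof.
move=> d /eqP; rewrite -subr_eq0 => /eqP e1 /eqP; rewrite -subr_eq0 => /eqP e2.
move: d e1 e2; case: u v P Q => [u1 u2] [v1 v2] [x y] [x' y'] /= d.
set E1 := (X in X = 0 -> _); set E2 := (X in _ -> X = 0 -> _) => e1 e2.
have a : v2 * E1 - u2 * E2 = 0 by rewrite e1 e2 !mulr0 subr0.
have b : u1 * E2 - v1 * E1 = 0 by rewrite e1 e2 !mulr0 subr0.
have b' : v1 * E1 - u1 * E2 = 0 by rewrite e1 e2 !mulr0 subr0.
rewrite {e1 e2}/E1 {}/E2 in a b b'.
congr (_, _); apply/eqP; rewrite -subr_eq0 -(mulrI_eq0 _ (mulfI d)); apply/eqP.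
- by case: col a b b' => /= a b b'; [rewrite -[RHS]a|rewrite -[RHS]a|rewrite -[RHS]b]; ring.
- by case: col a b b' => /= a b b'; [rewrite -[RHS]b|rewrite -[RHS]b'|rewrite -[RHS]a]; ring.
Qed.

Definition o0 : 'I_3 := @Ordinal 3 0 isT.
Definition o1 : 'I_3 := @Ordinal 3 1 isT.
Definition o2 : 'I_3 := @Ordinal 3 2 isT.

Lemma forall_I3 (P : 'I_3 -> Prop) :
  (forall i, P i) <-> [/\ P o0, P o1 & P o2].
Proof.
split=> [H|[H0 H1 H2]]; first by split.
case=> [[|[|[|//]]] h].
- by rewrite (_ : Ordinal h = o0) //; apply: val_inj.
- by rewrite (_ : Ordinal h = o1) //; apply: val_inj.
- by rewrite (_ : Ordinal h = o2) //; apply: val_inj.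
Qed.

Lemma cyc3 : ((ordS o0 = o1) * (ordS o1 = o2) * (ordS o2 = o0) *
  ((ord_pred o0 = o2) * (ord_pred o1 = o0) * (ord_pred o2 = o1)))%type.
Proof. by do !split; apply: val_inj. Qed.

Lemma triangle_det (F : fieldType) (T : triangle F) :
  (T o1).1 * (T o2).2 - (T o2).1 * (T o1).2
  + ((T o2).1 * (T o0).2 - (T o0).1 * (T o2).2)
  + ((T o0).1 * (T o1).2 - (T o1).1 * (T o0).2) != 0.
Proof.
have n12 : T o1 != T o2 by have := vertex_neq T o0; rewrite !cyc3.
apply/negP => /eqP d; apply: (@vertex_noncollinear _ T).
exists (join_line n12); apply/forall_I3; rewrite !on_mk_line; split; apply/eqP.
- by rewrite -[RHS]d; ring.
- by ring.
- by ring.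
Qed.

Lemma form_subl (F : fieldType) (col : colour) (P Q u : point F) :
  form col (vec P Q) u = form col Q u - form col P u.
Proof. by case: col => /=; ring. Qed.

(* Three lines perpendicular to the sides of a triangle, through points
   D 0, D 1, D 2 satisfying the relation of Carnot, are concurrent. *)
Lemma carnot (F : fieldType) (col : colour) (T : triangle F)
    (D : 'I_3 -> point F) :
  form col (D o0) (vec (T o1) (T o2)) + form col (D o1) (vec (T o2) (T o0))
    + form col (D o2) (vec (T o0) (T o1)) = 0 ->
  exists P : point F, [forall i, on P (altitude col (D i) (side T i))].
Proof.
move=> s; have d := triangle_det T.
have [|P [e0 e1]] := @form_solve _ col (vec (T o1) (T o2)) (vec (T o2) (T o0))
  (form col (D o0) (vec (T o1) (T o2))) (form col (D o1) (vec (T o2) (T o0))).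
  rewrite [X in X != 0](_ : _ = (T o1).1 * (T o2).2 - (T o2).1 * (T o1).2
    + ((T o2).1 * (T o0).2 - (T o0).1 * (T o2).2)
    + ((T o0).1 * (T o1).2 - (T o1).1 * (T o0).2)) //= ; ring.
exists P; apply/forallP/forall_I3; rewrite !on_altitude_join !cyc3 !form_subl.
rewrite e0 e1 !subrr eqxx; split=> //; apply/eqP.
rewrite -e0 -e1 in s; rewrite -[RHS]oppr0 -s.
by case: col {s e0 e1} => /=; ring.
Qed.

Lemma carnot_unique (F : fieldType) (col : colour) (T : triangle F)
    (D : 'I_3 -> point F) (P Q : point F) :
  (forall i, on P (altitude col (D i) (side T i))) ->
  (forall i, on Q (altitude col (D i) (side T i))) -> P = Q.
Proof.
move=> p q; have d := triangle_det T.
move: (p o0) (p o1) (q o0) (q o1) => {p q}.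
rewrite !on_altitude_join !cyc3 !form_subl !subr_eq0.
move=> /eqP p0 /eqP p1 /eqP q0 /eqP q1.
apply: (@form_inj _ col (vec (T o1) (T o2)) (vec (T o2) (T o0))).
- rewrite [X in X != 0](_ : _ = (T o1).1 * (T o2).2 - (T o2).1 * (T o1).2
    + ((T o2).1 * (T o0).2 - (T o0).1 * (T o2).2)
    + ((T o0).1 * (T o1).2 - (T o1).1 * (T o0).2)) //= ; ring.
- by rewrite p0 q0.
- by rewrite p1 q1.
Qed.

Lemma orthocenter_exists (F : fieldType) (col : colour) (T : triangle F) :
  exists H : point F, [forall i, on H (altitude col (T i) (side T i))].
Proof. by apply: carnot; case: col => /=; ring. Qed.

Definition orthocenter (F : fieldType) (col : colour) (T : triangle F) :
  point F := xchoose (orthocenter_exists col T).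

Lemma orthocenterP (F : fieldType) (col : colour) (T : triangle F) (i : 'I_3) :
  on (orthocenter col T) (altitude col (T i) (side T i)).
Proof. exact: (forallP (xchooseP (orthocenter_exists col T))). Qed.

Lemma orthocenter_unique (F : fieldType) (col : colour) (T : triangle F)
    (H : point F) :
  (forall i, on H (altitude col (T i) (side T i))) -> H = orthocenter col T.
Proof. by move=> h; apply: carnot_unique h (@orthocenterP _ col T). Qed.

Lemma circumcenter_exists (F : fieldType) (col : colour) (T : triangle F) :
  exists C : point F, [forall i, on C (perp_bisector col T i)].
Proof.
by apply: carnot; rewrite /side_midpoint !cyc3 /midpoint; case: col => /=; ring.
Qed.

Definition circumcenter (F : fieldType) (col : colour) (T : triangle F) :
  point F := xchoose (circumcenter_exists col T).

Lemma circumcenterP (F : fieldType) (col : colour) (T : triangle F)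
    (i : 'I_3) : on (circumcenter col T) (perp_bisector col T i).
Proof. exact: (forallP (xchooseP (circumcenter_exists col T))). Qed.

Lemma circumcenter_unique (F : fieldType) (col : colour) (T : triangle F)
    (C : point F) :
  (forall i, on C (perp_bisector col T i)) -> C = circumcenter col T.
Proof. by move=> h; apply: carnot_unique h (@circumcenterP _ col T). Qed.

(* ((x0, y0), K) stands for the equation with these parameters; in
   characteristic not two, distinct triples give distinct equations. *)

Definition circle (F : fieldType) (col : colour) : Type := (point F * F)%type.

Definition passes (F : fieldType) (col : colour) (C : circle F col)
    (P : point F) : bool :=
  let: ((x0, y0), K) := C in
  let: (x, y) := P in
  match col with
  | Blue => (x - x0) ^+ 2 + (y - y0) ^+ 2 == K
  | Red => (x - x0) ^+ 2 - (y - y0) ^+ 2 == K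
  | Green => 2 * (x - x0) * (y - y0) == K
  end.

Lemma passesE (F : fieldType) (col : colour) (C : circle F col) (P : point F) :
  passes C P = (form col (vec C.1 P) (vec C.1 P) == C.2).
Proof.
by case: C P => [[x0 y0] K] [x y]; case: col => /=; congr (_ == _); ring.
Qed.

Lemma pchar2_neq0 (F : fieldType) : 2%N \notin [pchar F] -> (2 : F) != 0.
Proof. by rewrite !inE. Qed.

Lemma midpoints_det (F : fieldType) (T : triangle F) (hF : 2%N \notin [pchar F])
    (u := vec (side_midpoint T o0) (side_midpoint T o1))
    (v := vec (side_midpoint T o0) (side_midpoint T o2)) :
  u.1 * v.2 - u.2 * v.1 != 0.
Proof.
have h2 := pchar2_neq0 hF; have d := triangle_det T.
rewrite [X in X != 0](_ : _ = ((T o1).1 * (T o2).2 - (T o2).1 * (T o1).2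
    + ((T o2).1 * (T o0).2 - (T o0).1 * (T o2).2)
    + ((T o0).1 * (T o1).2 - (T o1).1 * (T o0).2)) / (2 * 2)).
  by rewrite mulf_neq0 ?invr_eq0 ?mulf_neq0.
rewrite /u /v /side_midpoint !cyc3 /=; field.
by rewrite h2 (_ : 4 = 2 * 2) ?mulf_neq0 //; ring.
Qed.

Lemma form_equidist (F : fieldType) (col : colour) (hF : 2%N \notin [pchar F])
    (X P Q : point F) :
  form col X (vec P Q) = (form col Q Q - form col P P) / 2 <->
  form col (vec X Q) (vec X Q) = form col (vec X P) (vec X P).
Proof.
have h2 := pchar2_neq0 hF.
have e : form col (vec X Q) (vec X Q) - form col (vec X P) (vec X P) =
    - 2 * (form col X (vec P Q) - (form col Q Q - form col P P) / 2).
  by case: col => /=; field.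
split=> [E|/eqP].
  by apply/eqP; rewrite -subr_eq0 e E subrr mulr0.
rewrite -subr_eq0 e mulf_eq0 oppr_eq0 (negPf h2) /= subr_eq0.
by move/eqP.
Qed.

Lemma nine_point_circle_exists (F : fieldType) (hF : 2%N \notin [pchar F])
    (col : colour) (T : triangle F) :
  exists C : circle F col, [forall i, passes C (side_midpoint T i)].
Proof.
have [X [e1 e2]] := form_solve col
  ((form col (side_midpoint T o1) (side_midpoint T o1)
    - form col (side_midpoint T o0) (side_midpoint T o0)) / 2)
  ((form col (side_midpoint T o2) (side_midpoint T o2)
    - form col (side_midpoint T o0) (side_midpoint T o0)) / 2)
  (midpoints_det T hF).
exists (X, form col (vec X (side_midpoint T o0)) (vec X (side_midpoint T o0))).
apply/forallP/forall_I3; rewrite !passesE; split=> //; apply/eqP.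
- exact/(form_equidist col hF).
- exact/(form_equidist col hF).
Qed.

Definition nine_point_circle (F : fieldType) (hF : 2%N \notin [pchar F])
    (col : colour) (T : triangle F) : circle F col :=
  xchoose (nine_point_circle_exists hF col T).

Lemma nine_point_circleP (F : fieldType) (hF : 2%N \notin [pchar F])
    (col : colour) (T : triangle F) (i : 'I_3) :
  passes (nine_point_circle hF col T) (side_midpoint T i).
Proof. exact: (forallP (xchooseP (nine_point_circle_exists hF col T))). Qed.

Lemma nine_point_circle_unique (F : fieldType) (hF : 2%N \notin [pchar F])
    (col : colour) (T : triangle F) (C : circle F col) :
  (forall i, passes C (side_midpoint T i)) -> C = nine_point_circle hF col T.
Proof.
have := @nine_point_circleP _ hF col T; move: (nine_point_circle _ _ _) => D d c.
have eX (E : circle F col) (i : 'I_3) :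
    (forall j, passes E (side_midpoint T j)) ->
    form col E.1 (vec (side_midpoint T o0) (side_midpoint T i)) =
    (form col (side_midpoint T i) (side_midpoint T i)
     - form col (side_midpoint T o0) (side_midpoint T o0)) / 2.
  move=> e; apply/(form_equidist col hF).
  by move: (e i) (e o0); rewrite !passesE => /eqP -> /eqP ->.
have e1 : C.1 = D.1.
  apply: (form_inj (midpoints_det T hF)).
    exact: etrans (eX _ o1 c) (esym (eX _ o1 d)).
  exact: etrans (eX _ o2 c) (esym (eX _ o2 d)).
move: (c o0) (d o0); rewrite !passesE e1 => /eqP ec /eqP ed.
by move: ec ed e1; case: C D {c d eX} => [X K] [Y L] /= -> -> ->.
Qed.

(* Main.v *)
From mathcomp Require Import all_boot all_order all_algebra.
From mathcomp Require Import ring.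
Require Import Defs.

Set Implicit Arguments.
Unset Strict Implicit.
Unset Printing Implicit Defensive.

Import GRing.Theory.
Local Open Scope ring_scope.

(** Let H be the orthocenter, E the midpoint of H and a vertex A, and M the
    midpoint of the side opposite to A. The circle with diameter EM passes
    through the three midpoints of the sides, because the triangle formed by E,
    M and another such midpoint has legs parallel to a side and to the altitude
    on that side; hence it is the nine-point circle, which therefore passes
    through E, and through the foot D of the altitude from A since DE is
    perpendicular to DM. As for the circumcenter of another colour, it is the
    orthocenter of that colour of the medial triangle, and a circle through the
    vertices of a triangle passes through its orthocenters of the other two
    colours (as a rectangular hyperbola does in the Euclidean case). *)

Definition diameter_circle (F : fieldType) (col : colour) (P Q : point F) :
    circle F col :=
  (midpoint P Q,
   form col (vec (midpoint P Q) P) (vec (midpoint P Q) P)).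

(** Thales: with [M] the midpoint of [P] and [Q], the vectors XP and XQ are XM + MP and XM - MP, so
    their product is the difference of the squares of XM and MP. *)
Lemma passes_diameter_circle (F : fieldType) (hF : 2%N \notin [pchar F])
    (col : colour) (P Q X : point F) :
  passes (diameter_circle col P Q) X = (form col (vec X P) (vec X Q) == 0).
Proof.
have h2 := pchar2_neq0 hF.
rewrite passesE -subr_eq0; congr (_ == 0).
by case: col => /=; field.
Qed.

(** Seen from the midpoint of [C] and [A], the ends of the diameter lie at half of CH and minus half
    of AB. *)
Lemma diameter_circle_midpoint (F : fieldType) (hF : 2%N \notin [pchar F])
    (col : colour) (A B C H : point F) :
  form col (vec C H) (vec A B) = 0 ->
  passes (diameter_circle col (midpoint H A) (midpoint B C)) (midpoint C A).
Proof.
have h2 := pchar2_neq0 hF => e; rewrite passes_diameter_circle //; apply/eqP.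
have h4 : (4 : F) != 0 by rewrite (_ : 4 = 2 * 2) ?mulf_neq0 //; ring.
transitivity (form col (vec C H) (vec A B) / 4); last by rewrite e mul0r.
by case: col {e} => /=; field; rewrite ?h2 ?h4.
Qed.

Lemma midpointC (F : fieldType) (P Q : point F) : midpoint P Q = midpoint Q P.
Proof. by rewrite /midpoint addrC [P.2 + _]addrC. Qed.

Lemma form_vecC (F : fieldType) (col : colour) (u P Q : point F) :
  form col u (vec Q P) = - form col u (vec P Q).
Proof. by case: col => /=; ring. Qed.

(** By uniqueness the three diameters give one circle, so each vertex can be treated with its own
    diameter. *)
Lemma nine_point_circle_diameter (F : fieldType) (hF : 2%N \notin [pchar F])
    (col : colour) (T : triangle F) (i : 'I_3) :
  nine_point_circle hF col T =
  diameter_circle col (midpoint (orthocenter col T) (T i)) (side_midpoint T i).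
Proof.
apply/esym/nine_point_circle_unique.
have : forall k, form col (vec (T k) (orthocenter col T))
                          (vec (T (ordS k)) (T (ord_pred k))) = 0.
  by move=> k; apply/eqP; rewrite -(on_altitude_join _ _ _ (vertex_neq T k)) orthocenterP.
move: (orthocenter col T) => H /forall_I3; rewrite !cyc3 => -[h0 h1 h2].
have self (P Q : point F) : passes (diameter_circle col P Q) Q.
  rewrite passes_diameter_circle //; apply/eqP.
  by case: (col) => /=; rewrite !subrr !mulr0 ?addr0 ?subr0.
have next (A B C : point F) : form col (vec C H) (vec A B) = 0 ->
    passes (diameter_circle col (midpoint H A) (midpoint B C)) (midpoint C A).
  exact: diameter_circle_midpoint.
(* The mirror case of [next]: exchanging [B] and [C] only changes a sign in the hypothesis. *)
have prev (A B C : point F) : form col (vec B H) (vec C A) = 0 ->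
    passes (diameter_circle col (midpoint H A) (midpoint B C)) (midpoint A B).
  move=> e; rewrite (midpointC B C) (midpointC A B).
  by apply: next; rewrite form_vecC e oppr0.
by move: i; apply/forall_I3; split; apply/forall_I3;
  rewrite /side_midpoint !cyc3; split; auto.
Qed.

(** Parallelism gives [v.2 * form col w u = u.2 * form col w v], and likewise with first
    coordinates; a nonzero coordinate of [v] then cancels. The vector [u] may vanish. *)
Lemma form_parallel (F : fieldType) (col : colour) (w u v : point F) :
  (v.2 != 0) || (v.1 != 0) -> u.1 * v.2 = u.2 * v.1 ->
  form col w v = 0 -> form col w u = 0.
Proof.
move=> /orP[n|n] e f; apply: (mulfI n); rewrite mulr0.
- transitivity (u.2 * form col w v); last by rewrite f mulr0.
  by case: col {f} => /=; ring: e.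
- transitivity (u.1 * form col w v); last by rewrite f mulr0.
  by case: col {f} => /=; ring: e.
Qed.

Lemma diameter_circle_foot (F : fieldType) (hF : 2%N \notin [pchar F])
    (col : colour) (A B C D H : point F) (BC : B != C) :
  on D (join BC) -> on D (altitude col A (join BC)) ->
  on H (altitude col A (join BC)) ->
  passes (diameter_circle col (midpoint H A) (midpoint B C)) D.
Proof.
have h2 := pchar2_neq0 hF.
rewrite !on_altitude_join passes_diameter_circle //.
have /andP[jB jC] := joinP BC; rewrite (joinE BC jB jC) on_mk_line.
move=> /eqP dBC /eqP dA /eqP hA; apply/eqP.
apply: (@form_parallel _ _ _ _ (vec B C)) => /=.
- by rewrite -[C.2 - _]opprB oppr_eq0 join_coefs.
- apply/eqP; rewrite -subr_eq0 -[X in _ == X]dBC; apply/eqP; field.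
  exact: h2.
(* The vector from [D] to the midpoint of [H] and [A] is AH / 2 - AD. *)
- transitivity (form col (vec A H) (vec B C) / 2 - form col (vec A D) (vec B C)).
    by case: col {dA hA} => /=; field.
  by rewrite dA hA mul0r subrr.
Qed.

(* The left-hand side vanishes if and only if the circle of colour col through
   a, b and c (if they are not collinear) passes through the origin; col'' is
   the third colour. *)
Lemma third_colour (F : fieldType) (col col' : colour) : col' <> col ->
  exists (s : F) (col'' : colour), forall a b c : point F,
    (b.1 * c.2 - c.1 * b.2) * form col a a
    + (c.1 * a.2 - a.1 * c.2) * form col b b
    + (a.1 * b.2 - b.1 * a.2) * form col c c
    = s * (form col'' b c * form col' a (vec b c)
           + form col'' c a * form col' b (vec c a)
           + form col'' a b * form col' c (vec a b)).
Proof.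
case: col; case: col' => // _.
- by exists 1, Green => -[? ?] [? ?] [? ?] /=; ring.
- by exists (-1), Red => -[? ?] [? ?] [? ?] /=; ring.
- by exists 1, Green => -[? ?] [? ?] [? ?] /=; ring.
- by exists (-1), Blue => -[? ?] [? ?] [? ?] /=; ring.
- by exists (-1), Red => -[? ?] [? ?] [? ?] /=; ring.
- by exists 1, Blue => -[? ?] [? ?] [? ?] /=; ring.
Qed.

(** With [P] as origin, the perpendicularities kill every term on the right of [third_colour]. *)
Lemma passes_other_orthocenter (F : fieldType) (col col' : colour)
    (N : circle F col) (A B C P : point F) :
  col' <> col ->
  (vec A B).1 * (vec A C).2 - (vec A B).2 * (vec A C).1 != 0 ->
  passes N A -> passes N B -> passes N C ->
  form col' (vec P A) (vec B C) = 0 -> form col' (vec P B) (vec C A) = 0 ->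
  form col' (vec P C) (vec A B) = 0 -> passes N P.
Proof.
case: N => X K; rewrite !passesE /= => neq d /eqP eA /eqP eB /eqP eC fA fB fC.
have vecB (Q R : point F) : vec (vec P Q) (vec P R) = vec Q R.
  by congr (_, _) => /=; ring.
have [s [col'' /(_ (vec P A) (vec P B) (vec P C))]] := third_colour F neq.
rewrite !vecB fA fB fC !mulr0 !addr0 mulr0.
set S := (X in X = 0) => S0; rewrite -subr_eq0 -(mulrI_eq0 _ (mulfI d)).
(* The weights are barycentric coordinates of [P], scaled to have sum [d]. Expanding the squares of
   XA, XB, XC around [P], the linear terms cancel and the quadratic ones add up to [S]. *)
apply/eqP; transitivity (
  ((vec P B).1 * (vec P C).2 - (vec P C).1 * (vec P B).2)
    * (form col (vec X A) (vec X A) - K)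
  + ((vec P C).1 * (vec P A).2 - (vec P A).1 * (vec P C).2)
    * (form col (vec X B) (vec X B) - K)
  + ((vec P A).1 * (vec P B).2 - (vec P B).1 * (vec P A).2)
    * (form col (vec X C) (vec X C) - K) - S).
  by rewrite /S; case: (col) => /=; ring.
by rewrite eA eB eC S0 !subrr !mulr0 !addr0 subrr.
Qed.

(** Each side of the medial triangle is minus half of a side of [T], so the perpendicular bisectors
    of [T] are the medial altitudes. *)
Lemma form_circumcenter (F : fieldType) (hF : 2%N \notin [pchar F])
    (col : colour) (T : triangle F) (i : 'I_3) :
  form col (vec (circumcenter col T) (side_midpoint T i))
    (vec (side_midpoint T (ordS i)) (side_midpoint T (ord_pred i))) = 0.
Proof.
have h2 := pchar2_neq0 hF.
have : forall k, form col (vec (side_midpoint T k) (circumcenter col T))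
                          (vec (T (ordS k)) (T (ord_pred k))) = 0.
  move=> k; apply/eqP.
  by rewrite -(on_altitude_join _ _ _ (vertex_neq T k)) circumcenterP.
have half (A B C O M : point F) : form col (vec M O) (vec B C) = 0 ->
    form col (vec O M) (vec (midpoint C A) (midpoint A B)) = 0.
  move=> e; transitivity (form col (vec M O) (vec B C) / 2).
    by case: col {e} => /=; field.
  by rewrite e mul0r.
move: (circumcenter col T) => O /forall_I3; rewrite /side_midpoint !cyc3.
by move=> -[m0 m1 m2]; move: i; apply/forall_I3; rewrite !cyc3; split; apply: half.
Qed.

Theorem theorem23 (F : fieldType) (hF : 2%N \notin [pchar F]%R)
    (T : triangle F) (col : colour) :
  let N := nine_point_circle hF col T in
  [/\ forall (i : 'I_3) (nn : ~~ null col (side T i)),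
        passes N (foot (T i) nn),
      forall i : 'I_3, passes N (midpoint (orthocenter col T) (T i)) &
      forall col' : colour, col' <> col -> passes N (circumcenter col' T)].
Proof.
move=> N; split=> [i nn|i|col' neq].
- have /andP[fA fl] := footP (T i) nn.
  rewrite /N (nine_point_circle_diameter hF col T i).
  by apply: diameter_circle_foot fl fA _ => //; apply: orthocenterP.
- rewrite /N (nine_point_circle_diameter hF col T i) passes_diameter_circle //.
  by case: (col) => /=; rewrite !subrr !mul0r ?addr0 ?subr0.
- have := form_circumcenter hF col' T => /forall_I3; rewrite !cyc3 => -[f0 f1 f2].
  have m := nine_point_circleP hF col T.
  exact: (passes_other_orthocenter neq (midpoints_det T hF)
            (m o0) (m o1) (m o2) f0 f1 f2).
Qed.
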